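(* Let $\Bbbk$ be a field of characteristic $2$, let $E$ be a $\Bbbk$-vector space of dimension $n=2m+1\ge 3$, and let $(q_0,q_1)$ and $(q_0',q_1')$ be two regular pairs of quadratic forms on $E$ having the same half-discriminant polynomial $\Delta=\sum_{i=0}^n a_it_0^{n-i}t_1^i$, where $a_n\neq 0$. Suppose that they have normal forms with $r$-invariants $r$ and $r'$ in $A$, respectively. Then the pairs $(q_0,q_1)$ and $(q_0',q_1')$ are isomorphic if and only if \[ r\equiv r' \mod \Bbbk+\wp(A), \] where $\wp:A\to A$ is the Artin–Schreier map $\wp(s)=s^2+s$.
   Context: A quadratic form on $E$ is an element $q\in S^2E^\vee$; its polar form $b(v,w)=q(v+w)-q(v)-q(w)$ is alternating. A pair $(q_0,q_1)$ is regular if $V(q_0,q_1)$ is smooth over $\Bbbk$ and of codimension $2$ in the projective space $|E|$ of lines in $E$. An isomorphism between pairs $(q_0,q_1)$ and $(q_0',q_1')$ is an element $g\in\mathrm{GL}(E)$ with $q_0'(v)=q_0(gv)$ and $q_1'(v)=q_1(gv)$ for all $v\in E$. Half-discriminant: fix a volume form on $E$. For a quadratic form $q$ with polar form $b$ and a basis $e_1,\ldots,e_n$ of $E$ of volume $1$, put $\omega=\sum_i \mathrm{Pf}_i\,e_i$, where $\mathrm{Pf}_i$ is the Pfaffian of $(b(e_j,e_k))_{j,k}$ with $i$-th row and column deleted; set $\tfrac12\mathrm{disc}(q):=q(\omega)$. The half-discriminant polynomial of the pair is $\Delta(t_0,t_1):=\tfrac12\mathrm{disc}(t_0q_0+t_1q_1)=\sum_{i=0}^n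 a_it_0^{n-i}t_1^i$. Normal form: a basis $(x_0,\ldots,x_m,y_0,\ldots,y_{m-1})$ of $E^\vee$ and elements $r_0,\ldots,r_{n-2}\in\Bbbk$ such that $q_0=\sum_{i=0}^m a_{2i}x_i^2+\sum_{i=0}^{m-1}x_{i+1}y_i+\sum_{i=0}^{m-1}r_{2i+1}y_i^2$ and $q_1=\sum_{i=0}^m a_{2i+1}x_i^2+\sum_{i=0}^{m-1}x_iy_i+\sum_{i=0}^{m-1}r_{2i}y_i^2$, with $a_0,\dots,a_n$ the coefficients of $\Delta$. The $r$-invariant: let $f(T)=\Delta(1,T)=a_0+a_1T+\cdots+a_nT^n$, let $A=\Bbbk[T]/(f(T))$, and let $t$ be the image of $T$ in $A$. Put $d_i=a_{i+1}+a_{i+2}t+\cdots+a_nt^{n-1-i}$ for $i=0,\ldots,n-1$; these form a $\Bbbk$-basis of $A$. The $r$-invariant of the normal form is $r=r_0d_0+\cdots+r_{n-2}d_{n-2}\in A$. *)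

(* Defs.v *)
From HB Require Import structures.
From mathcomp Require Import all_boot all_order all_algebra.
From mathcomp Require Import mpoly.

Set Implicit Arguments.
Unset Strict Implicit.
Unset Printing Implicit Defensive.

Import GRing.Theory.
Local Open Scope ring_scope.

(* A quadratic form on E is a map E -> k that is homogeneous of degree 2 and
   whose polar form is bilinear. Such maps correspond bijectively to elements
   of S^2 E^*, over every field (see coef_mx and form_poly). *)

Definition polar (k : fieldType) (E : vectType k) (q : E -> k) (v w : E) : k :=
  q (v + w) - q v - q w.

Definition quadratic_form (k : fieldType) (E : vectType k) (q : E -> k) : Prop :=
  [/\ forall (c : k) v, q (c *: v) = c ^+ 2 * q v,
      forall v, scalar (fun w => polar q v w)
    & forall w, scalar (fun v => polar q v w)].

(* Upper triangular coefficients of q in the basis e: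
   q (\sum_i x_i e_i) = \sum_(i <= j) (coef_mx e q i j) x_i x_j. *)
Definition coef_mx (k : fieldType) (E : vectType k) (n : nat)
    (e : n.-tuple E) (q : E -> k) : 'M[k]_n :=
  \matrix_(i, j) if (i < j)%N then polar q (tnth e i) (tnth e j)
                 else if i == j then q (tnth e i) else 0.

Definition form_poly (k : fieldType) (E : vectType k) (n : nat)
    (e : n.-tuple E) (q : E -> k) : {mpoly k[n]} :=
  \sum_(i < n) \sum_(j < n) coef_mx e q i j *: ('X_i * 'X_j).

Definition isomorphic_pairs (k : fieldType) (E : vectType k)
    (q0 q1 q0' q1' : E -> k) : Prop :=
  exists g : 'End(E),
    bijective g /\ forall v, q0' v = q0 (g v) /\ q1' v = q1 (g v).

(* Points of the scheme P^(n-1) over k: homogeneous primes of k[X_1, .., X_n]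
   that do not contain all the variables. *)
Definition proj_point (k : fieldType) (n : nat) (P : {mpoly k[n]} -> Prop) :
    Prop :=
  [/\ P 0 /\ (forall p q, P p -> P q -> P (p + q)),
      forall p q, P q -> P (p * q),
      forall p q, P (p * q) -> P p \/ P q,
      forall d p, P p -> P (pihomog mdeg d p)
    & exists i : 'I_n, ~ P 'X_i].

Definition height_ge (k : fieldType) (n c : nat) (P : {mpoly k[n]} -> Prop) :
    Prop :=
  exists F : nat -> {mpoly k[n]} -> Prop,
    [/\ forall i, (i <= c)%N -> proj_point (F i),
        forall i, (i < c)%N ->
          (forall p, F i p -> F i.+1 p) /\ (exists p, F i.+1 p /\ ~ F i p)
      & forall p, F c p <-> P p].

Definition proj_zero (k : fieldType) (n s : nat) (G : s.-tuple {mpoly k[n]})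
    (P : {mpoly k[n]} -> Prop) : Prop :=
  proj_point P /\ forall i, P (tnth G i).

(* V(G) is nonempty of codimension c in P^(n-1): c is the least height of a
   point of V(G). *)
Definition proj_codim (k : fieldType) (n s : nat) (G : s.-tuple {mpoly k[n]})
    (c : nat) : Prop :=
  (forall P, proj_zero G P -> height_ge c P) /\
  (exists P, proj_zero G P /\ ~ height_ge c.+1 P).

Definition jacobian (k : fieldType) (n s : nat) (G : s.-tuple {mpoly k[n]})
    (x : 'I_n -> k) : 'M[k]_(s, n) :=
  \matrix_(i, j) ((tnth G i)^`M(j)).@[x].

(* V(G) is a smooth complete intersection of s hypersurfaces in P^(n-1):
   it has codimension s, hence pure codimension s as G has s members, and it is
   smooth over k: the Jacobian matrix has rank equal to the codimension at
   every point with values in an extension field of k. *)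
Definition smooth_complete_intersection (k : fieldType) (n s : nat)
    (G : s.-tuple {mpoly k[n]}) : Prop :=
  proj_codim G s /\
  forall (K : fieldType) (iota : {rmorphism k -> K}) (x : 'I_n -> K),
    let GK := map_tuple (map_mpoly iota) G in
    (exists i, x i != 0) -> (forall i, (tnth GK i).@[x] = 0) ->
    \rank (jacobian GK x) = s.

(* The condition does not depend on the basis used to identify |E| with
   P^(n-1). *)
Definition regular_pair (k : fieldType) (E : vectType k) (q0 q1 : E -> k) :
    Prop :=
  smooth_complete_intersection
    [tuple form_poly (vbasis {:E}) q0; form_poly (vbasis {:E}) q1].

Definition tuple_set (T : Type) (n : nat) (e : n.-tuple T) (i : 'I_n) (v : T) :
    n.-tuple T :=
  [tuple if j == i then v else tnth e j | j < n].

(* Meant for n = \dim E: nonzero alternating n-linear forms. *)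
Definition volume_form (k : fieldType) (E : vectType k) (n : nat)
    (vol : n.-tuple E -> k) : Prop :=
  [/\ forall e i, scalar (fun v => vol (tuple_set e i v)),
      forall (e : n.-tuple E) (i j : 'I_n),
        i != j -> tnth e i = tnth e j -> vol e = 0
    & exists e, vol e != 0].

(* Pfaffian, by expansion along the first row. *)
Fixpoint pfaffian (R : comNzRingType) (m : nat) : 'M[R]_(m.*2) -> R :=
  match m with
  | 0 => fun _ => 1
  | m'.+1 => fun A : 'M[R]_(m'.*2.+2) =>
      \sum_(j < m'.*2.+1) (-1) ^+ j * A ord0 (lift ord0 j) *
        pfaffian (row' j (col' j (row' ord0 (col' ord0 A))))
  end.

(* Half-discriminant of the quadratic form x |-> x Q x^T on row vectors over R,
   whose polar form has matrix Q + Q^T. The vector omega is written without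
   signs: this is the formula for rings of characteristic 2. *)
Definition half_disc (R : comNzRingType) (m : nat) (Q : 'M[R]_(m.*2.+1)) : R :=
  let B := Q + Q^T in
  let omega := \row_i pfaffian (row' i (col' i B)) in
  (omega *m Q *m omega^T) ord0 ord0.

Definition t0 (k : fieldType) : {mpoly k[2]} := 'X_(inord 0).
Definition t1 (k : fieldType) : {mpoly k[2]} := 'X_(inord 1).

(* Delta(t0, t1): the half-discriminant of t0 q0 + t1 q1 over k[t0, t1],
   computed in a basis e of volume 1. *)
Definition half_disc_poly (k : fieldType) (E : vectType k) (m : nat)
    (e : (m.*2.+1).-tuple E) (q0 q1 : E -> k) : {mpoly k[2]} :=
  half_disc (t0 k *: map_mx (@mpolyC 2 k) (coef_mx e q0)
             + t1 k *: map_mx (@mpolyC 2 k) (coef_mx e q1)).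

Definition binary_form (k : fieldType) (n : nat) (a : n.+1.-tuple k) :
    {mpoly k[2]} :=
  \sum_(i < n.+1) a`_i *: (t0 k ^+ (n - i) * t1 k ^+ i).

Definition normal_form (k : fieldType) (E : vectType k) (m : nat)
    (a : (m.*2.+2).-tuple k) (r : (m.*2).-tuple k) (q0 q1 : E -> k) : Prop :=
  exists (x : m.+1.-tuple 'Hom(E, k^o)) (y : m.-tuple 'Hom(E, k^o)),
  [/\ basis_of {: 'Hom(E, k^o)} (x ++ y),
      forall v : E, q0 v =
        \sum_(i < m.+1) a`_(i.*2) * (x`_i v) ^+ 2
        + \sum_(i < m) x`_i.+1 v * y`_i v
        + \sum_(i < m) r`_(i.*2.+1) * (y`_i v) ^+ 2
    & forall v : E, q1 v =
        \sum_(i < m.+1) a`_(i.*2.+1) * (x`_i v) ^+ 2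
        + \sum_(i < m) x`_i v * y`_i v
        + \sum_(i < m) r`_(i.*2) * (y`_i v) ^+ 2].

Definition dehomog_poly (k : fieldType) (n : nat) (a : n.+1.-tuple k) : {poly k} :=
  \poly_(i < n.+1) a`_i.

(* A = k[T]/(f). The library quotient {poly %/ h} expects a monic h of positive
   degree, so f is divided by its leading coefficient (which is a_n if a_n != 0);
   the ideal is unchanged. The image of 'X in the quotient is written 'qX. *)
Definition monic_dehomog (k : fieldType) (n : nat) (a : n.+1.-tuple k) : {poly k} :=
  (lead_coef (dehomog_poly a))^-1 *: dehomog_poly a.

Definition d_elt (k : fieldType) (n : nat) (a : n.+1.-tuple k) (i : nat) :
    {poly %/ monic_dehomog a} :=
  \sum_(i.+1 <= j < n.+1) a`_j *: ('qX : {poly %/ monic_dehomog a}) ^+ (j - i.+1).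

Definition r_invariant (k : fieldType) (m : nat) (a : (m.*2.+2).-tuple k)
    (r : (m.*2).-tuple k) : {poly %/ monic_dehomog a} :=
  \sum_(i < m.*2) r`_i *: d_elt a i.

Definition artin_schreier (A : nzRingType) (s : A) : A := s ^+ 2 + s.

(* Main.v *)
Require Import Defs.
From HB Require Import structures.
From mathcomp Require Import all_boot all_order all_algebra.
From mathcomp Require Import mpoly.
From mathcomp Require Import ring zify.

(** Write n = 2 m + 1 and let d_0, .., d_(n-1) be the basis of A = k[T]/(f) used
    to define the r-invariant. Both sides of the equivalence come down to the
    existence of scalars sigma_0, sigma_1, .. such that, for l < n - 1,

      r_l - r'_l = (coordinate along d_l of s^2) + sigma_l,
      where s = sum_i sigma_i d_i.

    On the algebraic side ([r_invariant_congr]), d_(n-1) = a_n is a nonzero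
    constant, so working modulo k means forgetting the last coordinate. The
    squares are given by d_i^2 = sum_l a_(2i+1-l) d_l, an identity special to
    characteristic 2 ([horner_tail_sqr]); hence the coordinate along d_l of s^2
    is sum_p a_(2p+1) sigma_(j+p)^2 if l = 2 j, and sum_p a_(2p) sigma_(j+p)^2 if
    l = 2 j + 1 ([sum_d_sqr]).

    On the geometric side ([isomorphic_normal_forms]), let e_0, .., e_m,
    f_0, .., f_(m-1) be the basis of E dual to the coordinates x_i, y_j. An
    isomorphism preserves both polar forms, and e_0, .., e_m is, up to a common
    factor, the only chain that starts in the kernel of the first polar form,
    ends in the kernel of the second one, and along which the second form at each
    vector equals the first one at the next ([Y_frame0], [X_diag]). The values of
    the quadratic forms on the chain are the a_i, and a_n <> 0, so the factor has
    square 1 and is 1. An isomorphism therefore fixes the y_j and translates the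
    x_i by combinations of the y_j. Preservation of the two polar forms makes the
    matrix of the translation a Hankel matrix (sigma_(i+j)) ([X_hankel]), and
    every such translation carries a normal form to a normal form with the same
    a, changing r_l by the quantity above ([nform_translate]): the squares x_i^2
    produce s^2 and the products x_i y_j produce s. *)

Set Implicit Arguments.
Unset Strict Implicit.
Unset Printing Implicit Defensive.

Import GRing.Theory.
Local Open Scope ring_scope.

(** * Symmetric sums in characteristic 2 *)

(** A product and its mirror image are the same term, and they cancel in
    characteristic 2; only a middle term, if there is one, survives. *)
Lemma palindromic_sums_pchar2 (R : comNzRingType) (h2 : 2%N \in [pchar R])
    (a : nat -> R) p :
  \sum_(l < p.*2.+1) a (p.*2 - l)%N * a l = a p ^+ 2 /\
  \sum_(l < p.*2.+2) a (p.*2.+1 - l)%N * a l = 0.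
Proof.
elim: p a => [|p IHp] a.
  rewrite !big_ord_recl !big_ord0 /= !addr0 expr2; split=> //.
  by rewrite mulrC addrr_pchar2.
have [even odd] := IHp (fun j => a j.+1).
have cancel N : (\sum_(l < N.+2) a (N.+1 - l)%N * a l =
    \sum_(l < N) a (N - l)%N * a l.+1).
  rewrite big_ord_recl big_ord_recr /= subn0 /bump leq0n add1n subnn.
  rewrite addrA addrC addrA [a 0 * _]mulrC addrr_pchar2 // add0r.
  by apply: eq_bigr => l _; rewrite add1n subSS.
split; rewrite doubleS cancel.
  by rewrite -even; apply: eq_bigr => l _; rewrite -subSn // -ltnS.
by rewrite -[RHS]odd; apply: eq_bigr => l _; rewrite -subSn // -ltnS.
Qed.

Lemma sum_sym_pchar2 (R : nzRingType) (h2 : 2%N \in [pchar R])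
    (c : nat -> nat -> R) (N : nat) :
    (forall i j, c i j = c j i) ->
  \sum_(i < N) \sum_(j < N) c i j = \sum_(i < N) c i i.
Proof.
move=> c_sym; elim: N => [|N IHN]; first by rewrite !big_ord0.
rewrite !big_ord_recr /= -IHN addrA; congr (_ + _).
under eq_bigr => i _ do rewrite big_ord_recr.
rewrite big_split /= -addrA; under [X in _ + (X + _)]eq_bigr do rewrite c_sym.
by rewrite addrr_pchar2 // addr0.
Qed.

(** * Squares of Horner tails *)

Section HornerTail.
Variables (k : comNzRingType) (A : comAlgType k) (a : nat -> k) (n : nat) (t : A).

(** The value at [t] of the polynomial part of f(T) / T^(i+1), where
    f = a_0 + a_1 T + .. + a_n T^n: these are the successive accumulators of the
    Horner scheme. *)
Definition horner_tail i : A := \sum_(i.+1 <= j < n.+1) a j *: t ^+ (j - i.+1).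

Lemma horner_tail_ge i : (n <= i)%N -> horner_tail i = 0.
Proof. by move=> le_ni; rewrite /horner_tail big_geq. Qed.

Hypothesis a_gt : forall j, (n < j)%N -> a j = 0.

Lemma horner_tail_rec i : horner_tail i = (a i.+1)%:A + t * horner_tail i.+1.
Proof.
have [le_ni | lt_in] := leqP n i.
  by rewrite !horner_tail_ge ?(leqW le_ni) // a_gt // scale0r mulr0 addr0.
rewrite /horner_tail big_ltn // subnn expr0 mulr_sumr; congr (_ + _).
rewrite !big_seq; apply: eq_bigr => j; rewrite mem_index_iota => /andP[lt_ij _].
by rewrite -scalerAr -exprS -subSn // subSS.
Qed.

Lemma horner_tail0 : t * horner_tail 0 = \sum_(j < n.+1) a j *: t ^+ j - (a 0%N)%:A.
Proof.
rewrite -(big_mkord xpredT (fun j => a j *: t ^+ j)) big_ltn // expr0.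
rewrite addrC addKr mulr_sumr !big_seq; apply: eq_bigr => j.
rewrite mem_index_iota => /andP[lt0j _].
by rewrite -scalerAr -exprS -subSn // subSS subn0.
Qed.

(** Descending induction on [i]. By the Horner recursion and characteristic 2,
    the square at [i] is a_(i+1)^2 plus t^2 times the square at [i + 1]. In the
    expansion of the latter, t^2 d_l is d_(l-2) up to an element of k + k t; as
    f(t) = 0 this remains true for l = 0 and l = 1, with d_(-1) = d_(-2) = 0.
    The d_(l-2) make up the expansion at [i], and the corrections add up to two
    palindromic sums: the one along 1 is a_(i+1)^2 and the one along t is 0. *)
Lemma horner_tail_sqr (h2 : 2%N \in [pchar k]) i :
    \sum_(j < n.+1) a j *: t ^+ j = 0 ->
  horner_tail i ^+ 2 =
    \sum_(l < i.*2.+2) a (i.*2.+1 - l)%N *: horner_tail l.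
Proof.
move=> root_t.
have h2A : 2%N \in [pchar A].
  by rewrite inE /= -[2%:R](scaler_nat 2) (pcharf0 h2) scale0r eqxx.
have [m] := ubnP (n - i); elim: m i => // m IHm i lt_m.
have [le_ni | lt_in] := leqP n i.
  rewrite horner_tail_ge // expr0n big1 // => l _.
  have [le_nl | lt_ln] := leqP n l; first by rewrite horner_tail_ge ?scaler0.
  by rewrite a_gt ?scale0r //; lia.
have /(congr1 (fun z => t ^+ 2 * z)) := IHm i.+1 ltac:(lia).
(* d_(l-2) and a_(l-1), extended by 0 to negative indices. *)
pose d' l := if l is l'.+2 then horner_tail l' else 0.
pose a' l := if l is l'.+1 then a l' else 0.
have shift l : t ^+ 2 * horner_tail l = d' l - (a' l)%:A - t * (a l)%:A.
  have t_tail j : t * horner_tail j.+1 = horner_tail j - (a j.+1)%:A.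
    by rewrite [horner_tail j]horner_tail_rec addrC addKr.
  rewrite expr2 -mulrA; case: l => [|[|l]] /=.
  - by rewrite horner_tail0 root_t sub0r mulrN scale0r subr0 sub0r.
  - by rewrite t_tail mulrBr horner_tail0 root_t !sub0r.
  - by rewrite t_tail mulrBr t_tail.
rewrite mulr_sumr (eq_bigr (fun l : 'I__ => a (i.+1.*2.+1 - l)%N *: d' l
  - (a (i.+1.*2.+1 - l)%N * a' l)%:A
  - t * (a (i.+1.*2.+1 - l)%N * a l)%:A)); last first.
  by move=> l _; rewrite -scalerAr shift !scalerBr !scalerA -!scalerAr scalerA.
rewrite !sumrB -mulr_sumr -!scaler_suml.
have [_ ->] := palindromic_sums_pchar2 h2 a i.+1.
rewrite scale0r mulr0 subr0 doubleS.
do 2![rewrite big_ord_recl /= scaler0 add0r].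
have -> : \sum_(l < i.*2.+4) a (i.*2.+3 - l)%N * a' l = a i.+1 ^+ 2.
  rewrite big_ord_recl /= mulr0 add0r.
  have [<- _] := palindromic_sums_pchar2 h2 a i.+1; rewrite doubleS.
  by apply: eq_bigr => l _; rewrite subSS.
move=> sqr_tail; rewrite horner_tail_rec sqrrD exprMn sqr_tail.
rewrite mulr2n addrr_pchar2 // addr0 exprZn expr1n addrC subrK.
by apply: eq_bigr => l _.
Qed.

(** The same expansion cut at l < n, since d_l = 0 for l >= n; the conditional
    is needed because truncated subtraction would give a_0 for l > 2 i + 1. *)
Lemma horner_tail_sqr_coords (h2 : 2%N \in [pchar k]) i :
    \sum_(j < n.+1) a j *: t ^+ j = 0 ->
  horner_tail i ^+ 2 =
    \sum_(l < n) (if (l <= i.*2.+1)%N then a (i.*2.+1 - l)%N else 0)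
                 *: horner_tail l.
Proof.
move=> root_t; rewrite horner_tail_sqr //.
(* Both sums are compared with one over a range that contains both. *)
pose F l := (if (l <= i.*2.+1)%N then a (i.*2.+1 - l)%N else 0) *: horner_tail l.
have widen N : (forall l, (N <= l)%N -> F l = 0) ->
    \sum_(l < N) F l = \sum_(l < i.*2.+2 + n) F l.
  move=> F0; have [/subnKC <- | lt_N] := leqP N (i.*2.+2 + n).
    rewrite big_split_ord /= [X in _ = _ + X]big1 ?addr0 // => l _.
    by rewrite F0 ?leq_addr.
  rewrite -(subnKC (ltnW lt_N)) big_split_ord /=.
  rewrite [X in _ + X = _]big1 ?addr0 // => l _.
  by rewrite /F horner_tail_ge ?scaler0 //; lia.
rewrite [RHS](widen n) => [|l le_nl]; last by rewrite /F horner_tail_ge ?scaler0.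
rewrite -(widen i.*2.+2) => [|l lt_l].
  by apply: eq_bigr => l _; rewrite /F -ltnS ltn_ord.
by rewrite /F leqNgt lt_l scale0r.
Qed.

End HornerTail.

(** The coordinate along d_l of the square of s = sum_i sigma_i d_i. Since
    2 i + 1 - l = 2 p + (1 - l mod 2) for i = floor(l/2) + p, only the
    coefficients [a] of index opposite in parity to [l] appear. The change of
    the coefficients [r] under a translation is given by the same sum. *)
Definition sqr_coord (k : fieldType) (m : nat) (a sigma : nat -> k) (l : nat) :
    k :=
  \sum_(p < m.+1) a (p.*2 + ~~ odd l)%N * sigma (l./2 + p)%N ^+ 2.

Lemma sqr_coordE (k : fieldType) (m : nat) (a sigma : nat -> k) (l : nat) :
    (forall j, (m.*2.+1 < j)%N -> a j = 0) -> (l < m.*2.+1)%N ->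
  \sum_(i < m.*2.+1)
     sigma i ^+ 2 * (if (l <= i.*2.+1)%N then a (i.*2.+1 - l)%N else 0) =
  sqr_coord m a sigma l.
Proof.
move=> a_gt lt_l.
have le_h : (l./2 <= m.*2.+1)%N by lia.
rewrite -(subnKC le_h) big_split_ord /= big1 ?add0r => [|i _]; last first.
  by rewrite leqNgt (_ : (i.*2.+1 < l)%N) ?mulr0 //; have := ltn_ord i; lia.
(* The terms with i = l./2 + p and p > m have a coefficient beyond a_n. *)
have le_m : (m.+1 <= m.*2.+1 - l./2)%N by lia.
rewrite -(subnKC le_m) big_split_ord /= [X in _ + X]big1 ?addr0 => [|p _].
  apply: eq_bigr => p _; rewrite mulrC.
  rewrite (_ : (l <= (l./2 + p).*2.+1)%N); last by lia.
  by congr (a _ * _); have := odd_double_half l; case: (odd l) => /=; lia.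
rewrite (_ : (l <= _)%N); last by lia.
rewrite a_gt ?mulr0 //; lia.
Qed.

(** * The quotient algebra and the r-invariant *)

Section QuotientAlgebra.
Variables (k : fieldType) (m : nat) (a : (m.*2.+2).-tuple k).
Hypothesis (h2 : 2%N \in [pchar k]) (a_lead : a`_(m.*2.+1) != 0).

Local Notation n := (m.*2.+1).
Local Notation f := (dehomog_poly a).
Local Notation A := {poly %/ monic_dehomog a}.
Local Notation t := ('qX : A).

Lemma size_dehomog : size f = n.+1.
Proof. by rewrite size_poly_eq. Qed.

Lemma lead_coef_dehomog_neq0 : lead_coef f != 0.
Proof. by rewrite lead_coef_eq0 -size_poly_gt0 size_dehomog. Qed.

Lemma mk_monic_dehomog : mk_monic (monic_dehomog a) = monic_dehomog a.
Proof.
rewrite /mk_monic size_scale ?invr_eq0 ?lead_coef_dehomog_neq0 // size_dehomog.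
by rewrite monicE lead_coefZ mulVf ?lead_coef_dehomog_neq0 //= eqxx.
Qed.

Lemma size_mk_monic_dehomog : size (mk_monic (monic_dehomog a)) = n.+1.
Proof.
rewrite mk_monic_dehomog size_scale ?invr_eq0 ?lead_coef_dehomog_neq0 //.
exact: size_dehomog.
Qed.

Lemma coef_tuple_gt j : (n < j)%N -> a`_j = 0.
Proof. by move=> lt_nj; rewrite nth_default ?size_tuple. Qed.

Lemma root_qX : \sum_(j < n.+1) a`_j *: t ^+ j = 0.
Proof.
transitivity (in_qpoly (monic_dehomog a) f).
  rewrite /dehomog_poly poly_def linear_sum; apply: eq_bigr => j _.
  by rewrite linearZ rmorphXn.
apply: val_inj; rewrite /= mk_monic_dehomog.
rewrite -(scale1r f) -(mulfV lead_coef_dehomog_neq0) -scalerA.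
rewrite -mul_polyC; apply: Pdiv.RingMonic.rmodp_mull.
by have := monic_mk_monic (monic_dehomog a); rewrite mk_monic_dehomog.
Qed.

Lemma dim_quotient : \dim {:A} = n.
Proof. by rewrite dim_polyn size_mk_monic_dehomog. Qed.

(** By dimension it is enough to generate. The element d_(n-1-j) is a_n t^j
    plus a combination of lower powers of t, so that all powers of t of exponent
    less than n are generated. *)
Lemma d_basis : basis_of {:A} [tuple d_elt a i | i < n].
Proof.
set d := [tuple _ | _ < _].
have dE i : (i < n)%N -> d_elt a i \in <<d>>%VS.
  move=> lt_in; apply: memv_span; apply/mapP; exists (Ordinal lt_in) => //.
  by rewrite mem_enum.
have t_in j : (j < n)%N -> t ^+ j \in <<d>>%VS.
  have [N] := ubnP j; elim: N j => // N IHN j lt_jN lt_jn.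
  have := dE (n.-1 - j)%N ltac:(lia); rewrite /d_elt.
  rewrite big_nat_recr /=; last by lia.
  have -> : (n - (m.*2 - j).+1 = j)%N by lia.
  rewrite rpredDl => [|]; last first.
    rewrite big_seq; apply: memv_suml => p; rewrite mem_index_iota => lt_p.
    by apply/memvZ/IHN; lia.
  by rewrite rpredZeq (negPf a_lead).
rewrite basisEdim size_tuple dim_quotient leqnn andbT.
apply/subvP => s _.
have lt_s := leq_trans (size_mk_monic s) (eq_leq size_mk_monic_dehomog).
have -> : s = in_qpoly (monic_dehomog a) (\poly_(j < size s) s`_j).
  by apply: val_inj; rewrite coefK [RHS]in_qpoly_small ?size_mk_monic.
rewrite poly_def linear_sum; apply: memv_suml => j _.
rewrite linearZ rmorphXn; apply/memvZ/t_in.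
exact: leq_trans (ltn_ord j) lt_s.
Qed.

Lemma d_last : d_elt a m.*2 = (a`_n)%:A.
Proof. by rewrite /d_elt big_nat1 subnn expr0. Qed.

Lemma d_sqr i : d_elt a i ^+ 2 =
  \sum_(l < n) (if (l <= i.*2.+1)%N then a`_(i.*2.+1 - l) else 0) *: d_elt a l.
Proof. exact: (horner_tail_sqr_coords coef_tuple_gt h2 i root_qX). Qed.

Lemma sum_d_sqr (sigma : nat -> k) :
  (\sum_(i < n) sigma i *: d_elt a i) ^+ 2 =
  \sum_(l < n) sqr_coord m (nth 0 a) sigma l *: d_elt a l.
Proof.
have h2A : 2%N \in [pchar A] by rewrite pchar_qpoly.
rewrite -(pFrobenius_autE h2A) rmorph_sum /=.
under eq_bigr => i _ do
  rewrite pFrobenius_autE exprZn d_sqr scaler_sumr.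
rewrite exchange_big /=; apply: eq_bigr => l _.
under eq_bigr => i _ do rewrite scalerA.
by rewrite -scaler_suml (sqr_coordE _ coef_tuple_gt).
Qed.

(** As d_(n-1) is a nonzero constant, an element of A is trivial modulo k
    exactly when its coordinates along the other d_l vanish. *)
Lemma r_invariant_congr (r r' : (m.*2).-tuple k) :
  (exists (c : k) (s : A),
     r_invariant a r - r_invariant a r' = c%:A + artin_schreier s) <->
  (exists sigma : nat -> k, forall l, (l < m.*2)%N ->
     r`_l - r'`_l = sqr_coord m (nth 0 a) sigma l + sigma l).
Proof.
have rE (u : (m.*2).-tuple k) :
    r_invariant a u = \sum_(l < n) u`_l *: d_elt a l.
  by rewrite big_ord_recr /= nth_default ?size_tuple // scale0r addr0.
have eq_diff (c : k) (sigma : nat -> k) :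
  (c * a`_n)%:A + artin_schreier (\sum_(i < n) sigma i *: d_elt a i) =
  \sum_(l < n) (sqr_coord m (nth 0 a) sigma l + sigma l
               + if l == m.*2 :> nat then c else 0) *: d_elt a l.
  rewrite /artin_schreier sum_d_sqr -big_split /=.
  under [RHS]eq_bigr => l _ do rewrite 2!scalerDl.
  rewrite [RHS]big_split /= addrC; congr (_ + _).
  rewrite big_ord_recr /= eqxx big1 ?add0r ?d_last ?scalerA // => l _.
  by rewrite ltn_eqF ?scale0r.
rewrite !rE -sumrB; split=> [[c [s]] | [sigma sigmaP]].
  pose sigma l :=
    if insub l is Some i then coord [tuple d_elt a i | i < n] i s else 0.
  have -> : s = \sum_(i < n) sigma i *: d_elt a i.
    rewrite [LHS](coord_basis d_basis (memvf s)); apply: eq_bigr => i _.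
    by rewrite /sigma valK -tnth_nth tnth_mktuple.
  rewrite -[c](divfK a_lead).
  rewrite eq_diff => eq_r; exists sigma => l lt_l.
  have lt_ln : (l < n)%N by lia.
  pose diff (i : 'I_n) := r`_i - r'`_i - (sqr_coord m (nth 0 a) sigma i + sigma i
    + if i == m.*2 :> nat then c / a`_n else 0).
  have /freeP/(_ diff) diff0 := basis_free d_basis.
  have /diff0/(_ (Ordinal lt_ln)) :
      \sum_(i < n) diff i *: [tuple d_elt a i | i < n]`_i = 0.
    under eq_bigr => i _ do rewrite -tnth_nth tnth_mktuple scalerBl scalerBl.
    by rewrite sumrB eq_r subrr.
  by rewrite /diff /= ltn_eqF // addr0 => /subr0_eq.
(* The constant absorbs the coordinate along d_(n-1). *)
pose c := - (sqr_coord m (nth 0 a) sigma m.*2 + sigma m.*2).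
exists (c * a`_n), (\sum_(i < n) sigma i *: d_elt a i).
rewrite eq_diff; apply: eq_bigr => l _; rewrite -scalerBl; congr (_ *: _).
have [-> | ne_l] := eqVneq (l : nat) m.*2.
  by rewrite !nth_default ?size_tuple // subr0 addrN.
by rewrite addr0 sigmaP //; have := ltn_ord l; lia.
Qed.

End QuotientAlgebra.

(** * Dual bases *)

Lemma separating_functionals (k : fieldType) (V : vectType k) (n : nat)
    (z : n.-tuple 'Hom(V, k^o)) (v : V) :
  basis_of {: 'Hom(V, k^o)} z -> (forall i : 'I_n, z`_i v = 0) -> v = 0.
Proof.
move=> z_basis zv0; rewrite (coord_vbasis (memvf v)); apply: big1 => i _.
suff -> : coord (vbasis {:V}) i v = 0 by rewrite scale0r.
pose phi : 'Hom(V, k^o) := linfun (coord (vbasis {:V}) i : V -> k^o).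
have -> : coord (vbasis {:V}) i v = phi v by rewrite lfunE.
rewrite (coord_basis z_basis (memvf phi)) sum_lfunE big1 // => j _.
by rewrite scale_lfunE zv0 scaler0.
Qed.

Lemma dual_vectors (k : fieldType) (V : vectType k) (n : nat)
    (z : n.-tuple 'Hom(V, k^o)) :
    basis_of {: 'Hom(V, k^o)} z ->
  exists w : 'I_n -> V, forall i j : 'I_n, z`_i (w j) = (i == j)%:R.
Proof.
move=> z_basis; pose ev (v : V) : 'rV[k]_n := \row_i z`_i v.
have ev_lin : linear ev.
  by move=> c u v; apply/rowP => i; rewrite !mxE linearP.
pose evL := GRing.isLinear.Build k V 'rV[k]_n *:%R ev ev_lin.
pose ev' : {linear V -> 'rV[k]_n} := HB.pack ev evL.
have ker0 : lker (linfun ev') == 0%VS.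
  apply/lker0P => u v; rewrite !lfunE => /rowP eq_uv.
  apply/eqP; rewrite -subr_eq0; apply/eqP/(separating_functionals z_basis) => i.
  by have := eq_uv i; rewrite !mxE linearB /= => ->; rewrite subrr.
have dimV : dim V = n.
  by have := vector.size_basis z_basis; rewrite dimvf /= /dim /= muln1.
have full : limg (linfun ev') = fullv.
  apply/eqP; rewrite eqEdim subvf limg_dim_eq; last first.
    by apply/eqP; rewrite (eqP ker0) capv0.
  by rewrite !dimvf dimV dim_matrix mul1r leqnn.
exists (fun j => (linfun ev')^-1%VF (delta_mx 0 j)) => i j.
have := limg_lfunVK (f := linfun ev') (x := delta_mx 0 j).
rewrite full memvf lfunE => /(_ isT)/rowP/(_ i).
by rewrite !mxE.
Qed.

(** * Isomorphisms of pairs in normal form *)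

Section NormalForms.
Variables (k : fieldType) (E : vectType k) (m : nat).
Hypothesis h2 : 2%N \in [pchar k].
Implicit Types (b : bool) (a r : nat -> k) (X Y : nat -> 'Hom(E, k^o)).

(** The two members of a pair in normal form: [b = true] is the first one and
    [b = false] the second one. With this encoding the coefficient of y_j^2 in
    the member [b] is r_l with l = 2 j + b. *)
Definition nform b a r X Y (v : E) : k :=
  \sum_(i < m.+1) a (i.*2 + ~~ b)%N * X i v ^+ 2
  + \sum_(i < m) X (i + b)%N v * Y i v
  + \sum_(i < m) r (i.*2 + b)%N * Y i v ^+ 2.

Definition nform_polar b X Y (u v : E) : k :=
  \sum_(i < m) (X (i + b)%N u * Y i v + X (i + b)%N v * Y i u).

Lemma sqrD_pchar2 (x y : k) : (x + y) ^+ 2 = x ^+ 2 + y ^+ 2.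
Proof. by rewrite sqrrD mulr2n addrr_pchar2 // addr0. Qed.

Lemma polar_nform b a r X Y u v :
  polar (nform b a r X Y) u v = nform_polar b X Y u v.
Proof.
rewrite /polar /nform /nform_polar.
have -> : \sum_(i < m.+1) a (i.*2 + ~~ b)%N * X i (u + v) ^+ 2 =
    \sum_(i < m.+1) a (i.*2 + ~~ b)%N * X i u ^+ 2
    + \sum_(i < m.+1) a (i.*2 + ~~ b)%N * X i v ^+ 2.
  by rewrite -big_split; apply: eq_bigr => i _; rewrite linearD sqrD_pchar2 mulrDr.
have -> : \sum_(i < m) r (i.*2 + b)%N * Y i (u + v) ^+ 2 =
    \sum_(i < m) r (i.*2 + b)%N * Y i u ^+ 2
    + \sum_(i < m) r (i.*2 + b)%N * Y i v ^+ 2.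
  by rewrite -big_split; apply: eq_bigr => i _; rewrite linearD sqrD_pchar2 mulrDr.
have -> : \sum_(i < m) X (i + b)%N (u + v) * Y i (u + v) =
    \sum_(i < m) X (i + b)%N u * Y i u + \sum_(i < m) X (i + b)%N v * Y i v
    + \sum_(i < m) (X (i + b)%N u * Y i v + X (i + b)%N v * Y i u).
  rewrite -!big_split; apply: eq_bigr => i _; rewrite !linearD /=; ring.
ring.
Qed.

Lemma nform_polarC b X Y u v : nform_polar b X Y u v = nform_polar b X Y v u.
Proof. by apply: eq_bigr => i _; rewrite addrC. Qed.

Definition x_frame X Y (P : nat -> E) : Prop := forall p, (p <= m)%N ->
  (forall i, (i <= m)%N -> X i (P p) = (i == p)%:R) /\
  (forall i, (i < m)%N -> Y i (P p) = 0).

Definition y_frame X Y (Q : nat -> E) : Prop := forall j, (j < m)%N ->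
  (forall i, (i <= m)%N -> X i (Q j) = 0) /\
  (forall i, (i < m)%N -> Y i (Q j) = (i == j)%:R).

Lemma polar_x_frame b X Y P p v : x_frame X Y P -> (p <= m)%N ->
  nform_polar b X Y (P p) v =
    if (b <= p)%N && (p - b < m)%N then Y (p - b)%N v else 0.
Proof.
move=> frameP le_pm; have [XP YP] := frameP p le_pm.
have term (i : 'I_m) :
    X (i + b)%N (P p) * Y i v + X (i + b)%N v * Y i (P p) =
    if (i + b == p)%N then Y i v else 0.
  rewrite XP ?YP ?ltn_ord //; last by have := ltn_ord i; case: (b); lia.
  by case: eqP; rewrite ?mul1r ?mul0r mulr0 addr0.
rewrite /nform_polar (eq_bigr _ (fun i _ => term i)).
case: ifP => [/andP[le_bp lt_pb] | p_out].
  rewrite (bigD1 (Ordinal lt_pb)) //= subnK // eqxx big1 ?addr0 // => i ne_i.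
  case: eqP => // eq_ip; case/eqP: ne_i; apply: val_inj => /=; lia.
rewrite big1 // => i _; case: eqP => // eq_ip; have := ltn_ord i; lia.
Qed.

Lemma polar_y_frame b X Y Q j v : y_frame X Y Q -> (j < m)%N ->
  nform_polar b X Y (Q j) v = X (j + b)%N v.
Proof.
move=> frameQ lt_jm; have [XQ YQ] := frameQ j lt_jm.
rewrite /nform_polar (bigD1 (Ordinal lt_jm)) //= big1 ?addr0 => [|i ne_ij].
  rewrite XQ ?YQ // ?eqxx ?mulr1 ?mul0r ?add0r //; case: (b); lia.
rewrite XQ ?YQ //; last by have := ltn_ord i; case: (b); lia.
rewrite mul0r add0r; case: eqP => [eq_ij | _]; last by rewrite mulr0.
by case/eqP: ne_ij; apply: val_inj.
Qed.

(** How far the two polar forms alone determine a coordinate system: up to the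
    ratio of the chains below and a Hankel translation of the x-coordinates. *)
Section Rigidity.
Variables (X Y X' Y' : nat -> 'Hom(E, k^o)) (P Q P' Q' : nat -> E).
Hypotheses (frameP : x_frame X Y P) (frameQ : y_frame X Y Q).
Hypotheses (frameP' : x_frame X' Y' P') (frameQ' : y_frame X' Y' Q').
Hypothesis polarE : forall b u v,
  nform_polar b X Y u v = nform_polar b X' Y' u v.

Lemma Y_polar b u i : (i < m)%N -> Y i u = nform_polar b X Y u (P (i + b)%N).
Proof.
move=> lt_im; rewrite nform_polarC (polar_x_frame _ _ frameP); last by case: (b); lia.
by rewrite leq_addl addnK lt_im.
Qed.

Lemma X_polar b u i : (i < m)%N -> X (i + b)%N u = nform_polar b X Y u (Q i).
Proof. by move=> lt_im; rewrite nform_polarC (polar_y_frame _ _ frameQ). Qed.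

Lemma polar_true0 v : nform_polar true X Y (P' 0%N) v = 0.
Proof. by rewrite polarE (polar_x_frame _ _ frameP'). Qed.

Lemma polar_false_last v : nform_polar false X Y (P' m) v = 0.
Proof. by rewrite polarE (polar_x_frame _ _ frameP') // subn0 ltnn. Qed.

Lemma polar_step p v : (p < m)%N ->
  nform_polar true X Y (P' p.+1) v = nform_polar false X Y (P' p) v.
Proof.
by move=> lt_pm; rewrite !polarE !(polar_x_frame _ _ frameP') ?(ltnW lt_pm) //.
Qed.

(** The vectors P'_0, .., P'_m form a chain for the pencil: P'_0 is in the kernel
    of the first polar form, P'_m in the kernel of the second one, and the
    second form at P'_p agrees with the first one at P'_(p+1). This is intrinsic
    to the pencil, and following the chain upwards from its start kills all the
    coordinates Y. *)
Lemma Y_frame0 p i : (p <= m)%N -> (i < m)%N -> Y i (P' p) = 0.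
Proof.
elim: p i => [|p IHp] i le_pm lt_im; first by rewrite (Y_polar true) // polar_true0.
rewrite (Y_polar true) // polar_step // nform_polarC.
rewrite (polar_x_frame _ _ frameP) addn1 // subn0 /=.
by case: ifP => // lt_im'; rewrite IHp // ltnW.
Qed.

Lemma X_shift d i p : (i + d <= m)%N -> (p + d <= m)%N ->
  X i (P' p) = X (i + d)%N (P' (p + d)%N).
Proof.
elim: d => [|d IHd] le_i le_p; first by rewrite !addn0.
rewrite IHd ?addnS; try lia.
have lt_i : (i + d < m)%N by lia.
have := X_polar true (P' (p + d).+1) lt_i; rewrite addn1 => ->.
by rewrite polar_step -?X_polar ?addn0 //; lia.
Qed.

(** The chain condition makes the matrix of X-coordinates constant along
    diagonals; every diagonal but the main one meets one of the two ends of the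
    chain, where its entry is 0. So the two chains are proportional. *)
Lemma X_diag i p : (i <= m)%N -> (p <= m)%N ->
  X i (P' p) = if i == p then X m (P' m) else 0.
Proof.
move=> le_im le_pm; case: (ltngtP i p) => [lt_ip | lt_pi | ->].
- rewrite (@X_shift (m - p)) ?(subnKC le_pm); try lia.
  have lt_i : (i + (m - p) < m)%N by lia.
  by have := X_polar false (P' m) lt_i; rewrite addn0 polar_false_last.
- have -> : X i (P' p) = X (i - p)%N (P' 0%N).
    by rewrite [RHS](@X_shift p) ?subnK ?add0n //; lia.
  have lt_i : ((i - p).-1 < m)%N by lia.
  have := X_polar true (P' 0%N) lt_i.
  by rewrite addn1 prednK ?subn_gt0 // polar_true0.
- by rewrite (@X_shift (m - p)) ?subnKC //; lia.
Qed.

(** The ratio of the two chains is normalised to 1, as forced by the values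
    of the quadratic forms on the chain. *)
Hypothesis X_last : X m (P' m) = 1.

Lemma x_frame_rigid : x_frame X Y P'.
Proof.
move=> p le_pm; split=> i le_im; last exact: Y_frame0.
by rewrite X_diag // X_last; case: eqP.
Qed.

Lemma Y_rigid i v : (i < m)%N -> Y i v = Y' i v.
Proof.
move=> lt_im; have := polarE false (P' i) v.
rewrite (polar_x_frame _ _ x_frame_rigid) ?(polar_x_frame _ _ frameP') ?(ltnW lt_im) //.
by rewrite subn0 lt_im.
Qed.

(** The vectors Q' span a subspace that is totally isotropic for both polar
    forms; expressed in the coordinates [(X, Y)] this is a symmetry. *)
Lemma X_sym b i j : (i < m)%N -> (j < m)%N ->
  X (j + b)%N (Q' i) = X (i + b)%N (Q' j).
Proof.
move=> lt_im lt_jm.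
have YQ' p q : (p < m)%N -> (q < m)%N -> Y p (Q' q) = (p == q)%:R.
  by move=> lt_p lt_q; rewrite Y_rigid //; have [_ ->] := frameQ' lt_q.
have := polarE b (Q' i) (Q' j); rewrite [RHS](polar_y_frame _ _ frameQ') //.
have [XQ' _] := frameQ' lt_jm; rewrite XQ'; last by case: (b); lia.
pose G (p q : nat) u := if p == q then X (p + b)%N u else 0.
have -> : nform_polar b X Y (Q' i) (Q' j) =
    \sum_(p < m) G p j (Q' i) + \sum_(p < m) G p i (Q' j).
  rewrite -big_split; apply: eq_bigr => p _; rewrite !YQ' // /G /=.
  by do 2!case: eqP; rewrite ?mulr1 ?mulr0.
have GE q u : (q < m)%N -> \sum_(p < m) G p q u = X (q + b)%N u.
  move=> lt_q; rewrite (bigD1 (Ordinal lt_q)) //= /G eqxx big1 ?addr0 // => p ne_pq.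
  by rewrite ifN //; apply: contra ne_pq => /eqP eq_pq; apply/eqP/val_inj.
by rewrite !GE // => /eqP; rewrite addr_eq0 oppr_pchar2 // => /eqP.
Qed.

Lemma X_hankel_step d i j : (i + d <= m)%N -> (j + d < m)%N ->
  X i (Q' (j + d)%N) = X (i + d)%N (Q' j).
Proof.
elim: d i j => [|d IHd] i j le_i lt_j; first by rewrite !addn0.
rewrite !addnS -!addSn; rewrite -IHd; try lia.
have := @X_sym true i (j + d)%N; have := @X_sym false i (j + d).+1.
rewrite !addn1 !addn0 => -> //; try lia; move=> <- //; lia.
Qed.

(** The two symmetries together say that the entry of indices i, j depends
    only on i + j. *)
Lemma X_hankel : exists sigma : nat -> k, forall i j, (i <= m)%N -> (j < m)%N ->
  X i (Q' j) = sigma (i + j)%N.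
Proof.
(* One entry on each antidiagonal of the (m + 1) x m matrix: in the first
   column if l <= m, and in the last row otherwise. *)
exists (fun l => X (minn l m) (Q' (l - m)%N)) => i j le_im lt_jm /=.
have [le_m | lt_m] := leqP (i + j) m.
  by rewrite (eqP le_m : (i + j - m = 0)%N) -(@X_hankel_step j).
have := @X_hankel_step (m - i) i (i + j - m).
rewrite subnKC // => <- //; last by lia.
by congr (X _ (Q' _)); lia.
Qed.

End Rigidity.

Lemma nform_x_vector b a r X Y u : (forall i, (i < m)%N -> Y i u = 0) ->
  nform b a r X Y u = \sum_(i < m.+1) a (i.*2 + ~~ b)%N * X i u ^+ 2.
Proof.
move=> Yu; rewrite /nform -addrA -big_split /= [X in _ + X]big1 ?addr0 // => i _.
by rewrite Yu // mulr0 expr0n mulr0 addr0.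
Qed.

Lemma nform_y_vector b a r X Y j u : (j < m)%N ->
    (forall i, (i < m)%N -> Y i u = (i == j)%:R) ->
  nform b a r X Y u = \sum_(i < m.+1) a (i.*2 + ~~ b)%N * X i u ^+ 2
                      + X (j + b)%N u + r (j.*2 + b)%N.
Proof.
move=> lt_jm Yu; rewrite /nform -!addrA; congr (_ + _).
rewrite -big_split (bigD1 (Ordinal lt_jm)) //= Yu // eqxx expr1n !mulr1.
rewrite big1 ?addr0 // => i ne_ij; rewrite Yu // (_ : (i == j :> nat) = false).
  by rewrite expr0n !mulr0 addr0.
by apply/negbTE; apply: contra ne_ij => /eqP eq_ij; apply/eqP/val_inj.
Qed.

Lemma sqr_coord_pair b a (sigma : nat -> k) j :
  sqr_coord m a sigma (j.*2 + b) =
  \sum_(i < m.+1) a (i.*2 + ~~ b)%N * sigma (i + j)%N ^+ 2.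
Proof.
apply: eq_bigr => i _; rewrite oddD odd_double oddb addnC halfD odd_double /=.
by rewrite doubleK; case: (b); rewrite /= add0n addn0 [(j + _)%N]addnC.
Qed.

(** The squares x_i^2 contribute the squares of the sigma, and each mixed sum
    x_(i+b) y_i contributes a symmetric bilinear expression in the y_j, of which
    only the diagonal survives in characteristic 2. *)
Lemma nform_translate b a r r' X Y X' Y' (sigma : nat -> k) u v :
    (forall i, (i <= m)%N ->
       X i u = X' i v + \sum_(j < m) sigma (i + j)%N * Y' j v) ->
    (forall j, (j < m)%N -> Y j u = Y' j v) ->
    (forall j, (j < m)%N -> r' (j.*2 + b)%N =
       sqr_coord m a sigma (j.*2 + b) + sigma (j.*2 + b)%N + r (j.*2 + b)%N) ->
  nform b a r' X' Y' v = nform b a r X Y u.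
Proof.
move=> XE YE rE.
have sqr_sum (c : 'I_m -> k) : (\sum_j c j) ^+ 2 = \sum_j c j ^+ 2.
  by rewrite -(pFrobenius_autE h2) rmorph_sum; apply: eq_bigr => j _.
have xx : \sum_(i < m.+1) a (i.*2 + ~~ b)%N * X i u ^+ 2 =
    \sum_(i < m.+1) a (i.*2 + ~~ b)%N * X' i v ^+ 2
    + \sum_(j < m) sqr_coord m a sigma (j.*2 + b) * Y' j v ^+ 2.
  under [X in _ = _ + X]eq_bigr => j _ do rewrite sqr_coord_pair mulr_suml.
  rewrite exchange_big -big_split; apply: eq_bigr => i _ /=.
  rewrite XE -1?ltnS // sqrD_pchar2 sqr_sum mulrDr mulr_sumr; congr (_ + _).
  by apply: eq_bigr => j _; rewrite exprMn mulrA.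
have xy : \sum_(i < m) X (i + b)%N u * Y i u =
    \sum_(i < m) X' (i + b)%N v * Y' i v
    + \sum_(j < m) sigma (j.*2 + b)%N * Y' j v ^+ 2.
  pose c i j := sigma (i + j + b)%N * (Y' i v * Y' j v).
  have c_sym i j : c i j = c j i by rewrite /c (addnC i j) (mulrC (Y' i v)).
  have -> : \sum_(j < m) sigma (j.*2 + b)%N * Y' j v ^+ 2 = \sum_(j < m) c j j.
    by apply: eq_bigr => j _; rewrite /c addnn expr2.
  rewrite -(sum_sym_pchar2 h2 m c_sym) -big_split; apply: eq_bigr => i _ /=.
  rewrite XE ?YE //; last by have := ltn_ord i; case: (b); lia.
  rewrite mulrDl mulr_suml; congr (_ + _); apply: eq_bigr => j _.
  by rewrite /c addnAC mulrAC mulrA.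
have yy : \sum_(j < m) r' (j.*2 + b)%N * Y' j v ^+ 2 =
    \sum_(j < m) sqr_coord m a sigma (j.*2 + b) * Y' j v ^+ 2
    + \sum_(j < m) sigma (j.*2 + b)%N * Y' j v ^+ 2
    + \sum_(j < m) r (j.*2 + b)%N * Y j u ^+ 2.
  by rewrite -!big_split; apply: eq_bigr => j _; rewrite rE // YE // !mulrDl.
by rewrite /nform xx xy yy; ring.
Qed.

Definition nform_frame (X Y : nat -> 'Hom(E, k^o)) (P Q : nat -> E) : Prop :=
  [/\ x_frame X Y P, y_frame X Y Q
    & forall v, (forall i, (i <= m)%N -> X i v = 0) ->
                (forall j, (j < m)%N -> Y j v = 0) -> v = 0].

Lemma normal_form_frame (a : (m.*2.+2).-tuple k) (r : (m.*2).-tuple k) q0 q1 :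
    normal_form a r q0 q1 ->
  exists X Y P Q, nform_frame X Y P Q /\
    forall v, q0 v = nform true (nth 0 a) (nth 0 r) X Y v /\
              q1 v = nform false (nth 0 a) (nth 0 r) X Y v.
Proof.
case=> x [y [xy_basis q0E q1E]].
pose z : (m.+1 + m).-tuple _ := cat_tuple x y.
have z_basis : basis_of {:'Hom(E, k^o)} z by [].
have [w zw] := dual_vectors z_basis.
have zx i : (i <= m)%N -> z`_i = x`_i.
  by move=> le_im; rewrite nth_cat size_tuple ltnS le_im.
have zy j : z`_(m.+1 + j) = y`_j.
  by rewrite nth_cat size_tuple ltnNge leq_addr addKn.
pose e p := w (inord p : 'I_(m + m).+1).
have ze i p : (i < m.+1 + m)%N -> (p < m.+1 + m)%N -> z`_i (e p) = (i == p)%:R.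
  move=> lt_i lt_p; have := zw (Ordinal lt_i) (inord p : 'I_(m + m).+1).
  by rewrite /e /= => ->; rewrite -val_eqE /= inordK.
exists (nth 0 x), (nth 0 y), e, (fun j => e (m.+1 + j)%N); split; first split.
- move=> p le_pm; split=> i lt_im; first by rewrite -zx // ze //; lia.
  have ne_p : (m.+1 + i == p)%N = false by lia.
  by rewrite -zy ze ?ne_p //; lia.
- move=> j lt_jm; split=> i lt_im; last by rewrite -zy ze ?eqn_add2l //; lia.
  have ne_j : (i == m.+1 + j)%N = false by lia.
  by rewrite -zx // ze ?ne_j //; lia.
- move=> v Xv Yv; apply: (separating_functionals z_basis) => i.
  have [le_im | lt_mi] := leqP i m; first by rewrite zx ?Xv.
  rewrite -(subnKC lt_mi) zy Yv //; have := ltn_ord i; lia.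
move=> v; rewrite q0E q1E /nform; split; congr (_ + _ + _); apply: eq_bigr => i _;
  by rewrite ?addn0 ?addn1.
Qed.

(** An isomorphism transports the coordinates of the first pair to a second
    coordinate system for the other pair. Rigidity leaves only translations of
    the x_i by Hankel combinations of the y_j, and the values at the vectors Q'
    give the change of r. Conversely such a translation is invertible. *)
Lemma isomorphic_normal_forms (a : (m.*2.+2).-tuple k) (r r' : (m.*2).-tuple k)
    (q0 q1 q0' q1' : E -> k) (a_lead : a`_(m.*2.+1) != 0) :
    normal_form a r q0 q1 -> normal_form a r' q0' q1' ->
  isomorphic_pairs q0 q1 q0' q1' <->
  exists sigma : nat -> k, forall l, (l < m.*2)%N ->
    r`_l - r'`_l = sqr_coord m (nth 0 a) sigma l + sigma l.
Proof.
case/normal_form_frame=> X [Y [P [Q [[frameP frameQ sepXY] qE]]]].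
case/normal_form_frame=> X' [Y' [P' [Q' [[frameP' frameQ' sepXY'] qE']]]].
have diffE l (c : k) : r`_l - r'`_l = c <-> r'`_l = c + r`_l.
  rewrite oppr_pchar2 //; split=> [<- | ->].
    by rewrite addrAC addrr_pchar2 // add0r.
  by rewrite addrCA addrr_pchar2 // addr0.
split=> [[g [[g' gK g'K] q'E]] | [sigma sigmaE]].
  pose Xg i := (X i \o g)%VF; pose Yg i := (Y i \o g)%VF.
  have nformE b v : nform b (nth 0 a) (nth 0 r) Xg Yg v =
                    nform b (nth 0 a) (nth 0 r') X' Y' v.
    transitivity (nform b (nth 0 a) (nth 0 r) X Y (g v)).
      congr (_ + _ + _); apply: eq_bigr => i _; by rewrite !comp_lfunE.
    have [q0'E q1'E] := q'E v; have [q0E q1E] := qE (g v).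
    have [q0E' q1E'] := qE' v.
    by case: b; rewrite -?q0E -?q1E -?q0E' -?q1E' -?q0'E -?q1'E.
  have framePg : x_frame Xg Yg (g' \o P).
    move=> p /frameP[XP YP].
    by split=> i lt_i; rewrite comp_lfunE /= g'K ?XP ?YP.
  have frameQg : y_frame Xg Yg (g' \o Q).
    move=> p /frameQ[XQ YQ].
    by split=> i lt_i; rewrite comp_lfunE /= g'K ?XQ ?YQ.
  have polarE b u v : nform_polar b Xg Yg u v = nform_polar b X' Y' u v.
    rewrite -(polar_nform b (nth 0 a) (nth 0 r)).
    by rewrite -(polar_nform b (nth 0 a) (nth 0 r')) /polar !nformE.
  (* The second form takes at the last vector of the chain the value a_n in
     one system and a_n c^2 in the other, so c^2 = 1 and then c = 1. *)
  have X_last : Xg m (P' m) = 1.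
    have [XP' YP'] := frameP' m (leqnn m).
    have := nformE false (P' m).
    have Yg0 := Y_frame0 framePg frameP' polarE (leqnn m).
    rewrite (nform_x_vector _ _ _ _ YP') (nform_x_vector _ _ _ _ Yg0).
    have last_coord (Z : nat -> 'Hom(E, k^o)) :
        (forall i, (i < m)%N -> Z i (P' m) = 0) ->
        \sum_(i < m.+1) a`_(i.*2 + ~~ false) * Z i (P' m) ^+ 2 =
        a`_(m.*2.+1) * Z m (P' m) ^+ 2.
      move=> Z0; rewrite big_ord_recr /= addn1 big1 ?add0r // => i _.
      by rewrite /= Z0 // expr0n mulr0.
    rewrite !last_coord => [|i lt_im|i lt_im]; first last.
    - by rewrite (X_diag frameQg frameP' polarE) ?ltn_eqF // ltnW.
    - by rewrite XP' ?ltn_eqF // ltnW.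
    move=> /(mulfI a_lead); rewrite XP' // eqxx => sqr1.
    have := sqrD_pchar2 (Xg m (P' m)) 1; rewrite sqr1 addrr_pchar2 //.
    by move=> /eqP; rewrite sqrf_eq0 addr_eq0 oppr_pchar2 // => /eqP.
  have rigid := Y_rigid framePg frameQg frameP' polarE X_last.
  have [sigma XE] := X_hankel framePg frameQg frameP' frameQ' polarE X_last.
  (* Both normal forms are evaluated at the vector Q'_j, where l = 2 j + b. *)
  exists sigma => l lt_l; apply/diffE.
  have lt_j : (l./2 < m)%N by lia.
  have [XQ' YQ'] := frameQ' _ lt_j.
  have lE : (l./2.*2 + odd l = l)%N by rewrite addnC odd_double_half.
  have := nformE (odd l) (Q' l./2).
  rewrite !(nform_y_vector _ _ _ _ lt_j) => [|//|i lt_im]; last first.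
    by rewrite rigid // YQ'.
  rewrite lE [X in _ = X + _ + _]big1 ?add0r => [|i _]; last first.
    by rewrite XQ' -1?ltnS // expr0n mulr0.
  rewrite XQ' ?add0r => [<-|]; last by case: (odd l); lia.
  rewrite XE //; last by case: (odd l); lia.
  have := sqr_coord_pair (odd l) (nth 0 a) sigma l./2; rewrite lE => ->; congr (_ + _ + _).
    by apply: eq_bigr => i _; rewrite XE // -ltnS.
  by congr sigma; lia.
(* The isomorphism sends a vector to the one whose coordinates in the first
   system are its own translated coordinates in the second. *)
pose Xs i v := X' i v + \sum_(j < m) sigma (i + j)%N * Y' j v.
pose g v := \sum_(i < m.+1) Xs i v *: P i + \sum_(j < m) Y' j v *: Q j.
have Xg i v : (i <= m)%N -> X i (g v) = Xs i v.
  move=> le_im; rewrite linearD !linear_sum /=.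
  rewrite [X in _ + X]big1 ?addr0 => [|j _]; last first.
    have [XQ _] := frameQ j (ltn_ord j).
    by rewrite linearZ /= XQ // scaler0.
  have lt_im : (i < m.+1)%N by [].
  rewrite (bigD1 (Ordinal lt_im)) //= big1 ?addr0 => [|p ne_p].
    have [XP _] := frameP i le_im.
    by rewrite linearZ /= XP // eqxx [LHS]mulr1.
  have [XP _] := frameP p (ltn_ord p).
  rewrite linearZ /= XP // (_ : (i == p) = false) ?scaler0 //.
  by apply/negbTE; apply: contra ne_p => /eqP eq_ip; apply/eqP/val_inj.
have Yg j v : (j < m)%N -> Y j (g v) = Y' j v.
  move=> lt_jm; rewrite linearD !linear_sum /=.
  rewrite [X in X + _]big1 ?add0r => [|i _]; last first.
    have [_ YP] := frameP i (ltn_ord i).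
    by rewrite linearZ /= YP // scaler0.
  rewrite (bigD1 (Ordinal lt_jm)) //= big1 ?addr0 => [|p ne_p].
    have [_ YQ] := frameQ j lt_jm.
    by rewrite linearZ /= YQ // eqxx [LHS]mulr1.
  have [_ YQ] := frameQ p (ltn_ord p).
  rewrite linearZ /= YQ // (_ : (j == p) = false) ?scaler0 //.
  by apply/negbTE; apply: contra ne_p => /eqP eq_ip; apply/eqP/val_inj.
have Xs_linear i : linear (Xs i : E -> k^o).
  move=> c u v; rewrite /Xs linearP scalerDr addrACA; congr (_ + _).
  rewrite scaler_sumr -big_split; apply: eq_bigr => j _ /=.
  by rewrite linearP mulrDr; congr (_ + _); rewrite -[LHS]/(_ * (_ * _)) mulrCA.
have g_linear : linear g.
  move=> c u v; rewrite /g scalerDr !scaler_sumr addrACA -!big_split.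
  congr (_ + _); apply: eq_bigr => i _ /=.
    by rewrite Xs_linear scalerDl scalerA.
  by rewrite linearP scalerDl scalerA.
pose gL : {linear E -> E} := HB.pack g (GRing.isLinear.Build k E E *:%R g g_linear).
have g_inj : injective (linfun gL).
  apply/lker0P; rewrite -subv0; apply/subvP => v; rewrite memv_ker lfunE /= => /eqP gv0.
  rewrite memv0; apply/eqP/sepXY'.
    move=> i le_im; have := Xg i v le_im; rewrite gv0 linear0 /Xs big1 ?addr0 => [->//|j _].
    by rewrite -Yg // gv0 linear0 mulr0.
  by move=> j lt_jm; rewrite -Yg // gv0 linear0.
exists (linfun gL); split.
  exists (linfun gL)^-1%VF; first exact/lker0_lfunK/lker0P.
  exact/lker0_lfunVK/lker0P.
move=> v; rewrite lfunE /=; have [-> ->] := qE (g v); have [-> ->] := qE' v.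
have rE b j : (j < m)%N -> r'`_(j.*2 + b) =
    sqr_coord m (nth 0 a) sigma (j.*2 + b) + sigma (j.*2 + b)%N + r`_(j.*2 + b).
  by move=> lt_jm; apply/diffE/sigmaE; case: b; lia.
split; apply: (nform_translate (sigma := sigma) _ _ (rE _)) => i lt_i;
  by rewrite ?Xg ?Yg.
Qed.

End NormalForms.

(** * The classification *)

Theorem theorem1p4 (k : fieldType) (hk : 2%N \in [pchar k])
    (m : nat) (hm : (3 <= m.*2.+1)%N)
    (E : vectType k) (hE : \dim {:E} = m.*2.+1)
    (vol : (m.*2.+1).-tuple E -> k) (hvol : volume_form vol)
    (e : (m.*2.+1).-tuple E) (he : vol e = 1)
    (q0 q1 q0' q1' : E -> k)
    (hq0 : quadratic_form q0) (hq1 : quadratic_form q1)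
    (hq0' : quadratic_form q0') (hq1' : quadratic_form q1')
    (hreg : regular_pair q0 q1) (hreg' : regular_pair q0' q1')
    (a : (m.*2.+2).-tuple k)
    (hDelta : half_disc_poly e q0 q1 = binary_form a)
    (hDelta' : half_disc_poly e q0' q1' = binary_form a)
    (han : a`_(m.*2.+1) != 0)
    (r r' : (m.*2).-tuple k)
    (hr : normal_form a r q0 q1) (hr' : normal_form a r' q0' q1') :
  isomorphic_pairs q0 q1 q0' q1' <->
  exists (c : k) (s : {poly %/ monic_dehomog a}),
    r_invariant a r - r_invariant a r' = c%:A + artin_schreier s.
Proof.
apply: iff_trans (isomorphic_normal_forms hk han hr hr') _.
exact: iff_sym (r_invariant_congr hk han r r').
Qed.
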